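(* For every even $n\ge2$ there exists a simple (undirected, loopless) quantum graph on $M_n$ of the form $X_{A,\cdot,C}$ such that $X_{A,\cdot,C}$ has twice as many connected components as its strange graph $\mathfrak G(A,C)$.
   Context: $M_n=M_n(\mathbb C)$, with matrix units $E_{ij}$; ''projector'' means orthogonal projector. For $A,C\in M_n$ with zero diagonal, $$X_{A,\cdot,C}(x)=\sum_{i\ne j}A_{ij}\,x_{jj}E_{ii}+\sum_{i\neq j}C_{ij}\,x_{ji}E_{ij}.$$ A quantum graph on $M_n$ is a linear map $G\colon M_n\to M_n$ with $\sum_{k} G(E_{ik})G(E_{kj})=G(E_{ij})$ for all $i,j$ and $G(x^\dagger)=G(x)^\dagger$; it is undirected if self-adjoint for $\langle x,y\rangle=\mathrm{Tr}(x^\dagger y)$, and loopless if $\sum_k G(E_{ik})E_{kj}=0$ for all $i,j$. (Equivalently for $X_{A,\cdot,C}$: $A=A^T$ and $X_{ij}:=\begin{pmatrix} A_{ij} & C_{ij} \\ C_{ji} & A_{ji} \end{pmatrix}$ is a projector for all $i\neq j$.) Each such $X_{ij}$ ($i<j$) is $0$, $I$, or $\frac12\begin{pmatrix} 1 & e^{\mathrm i\theta} \\ e^{-\mathrm i\theta} & 1 \end{pmatrix}$ with $\theta\in[0,2\pi)$. The strange graph $\mathfrak G(A,C)$ is the undirected graph on $\{1,\dots,n\}$ with a classical edge $\{i,j\}$ when $X_{ij}=I$, a strange edge $\{i,j\}$ ($i<j$) of phase $\theta$ when $X_{ij}=\frac12\begin{pmatrix} 1 & e^{\mathrm i\theta}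 \\ e^{-\mathrm i\theta} & 1 \end{pmatrix}$, and no edge when $X_{ij}=0$; its connected components are those of the ordinary graph with all edges. A quantum graph $G$ has (at least) $k$ connected components if there exist non-zero projectors $P_1,\dots,P_k$ on $\mathbb C^n$ with $\sum_sP_s=I$ such that $L_{P_s}\,G\,L_{P_t}=0$ for all $s\ne t$, where $L_P(x)=Px$; its number of connected components is the largest such $k$. *)

(* Defs.v *)
From HB Require Import structures.
From mathcomp Require Import all_boot all_order all_algebra.
From mathcomp Require Import complex.
From mathcomp Require Import boolp reals trigo.

Set Implicit Arguments.
Unset Strict Implicit.
Unset Printing Implicit Defensive.

Import Order.TTheory GRing.Theory Num.Theory.
Local Open Scope ring_scope.
Local Open Scope complex_scope.
Local Open Scope sesquilinear_scope.

(* R[i] is the field of complex numbers over R : realType, x ^t* is the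
   conjugate transpose of x, and delta_mx i j is the matrix unit E_ij. *)

Section QuantumGraphs.
Variables (R : realType) (n : nat).
Implicit Types (P : 'M[R[i]]_n) (G : {linear 'M[R[i]]_n -> 'M[R[i]]_n}).

Definition projector P : Prop := P *m P = P /\ P ^t* = P.

Definition quantum_graph G : Prop :=
  (forall i j : 'I_n,
     \sum_k G (delta_mx i k) *m G (delta_mx k j) = G (delta_mx i j))
  /\ (forall x, G (x ^t*) = (G x) ^t*).

Definition hs_inner (x y : 'M[R[i]]_n) : R[i] := \tr (x ^t* *m y).

Definition undirected G : Prop :=
  forall x y, hs_inner (G x) y = hs_inner x (G y).

Definition loopless G : Prop :=
  forall i j : 'I_n, \sum_k G (delta_mx i k) *m delta_mx k j = 0.

Definition has_components G (k : nat) : Prop :=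
  exists P : 'I_k -> 'M[R[i]]_n,
    [/\ forall s, projector (P s) /\ P s != 0,
        \sum_s P s = 1%:M &
        forall s t, s != t -> forall x, P s *m G (P t *m x) = 0].

Definition num_components G (k : nat) : Prop :=
  has_components G k /\ forall m, has_components G m -> (m <= k)%N.

Definition zero_diagonal (A : 'M[R[i]]_n) : Prop := forall i, A i i = 0.

Definition XAC (A C x : 'M[R[i]]_n) : 'M[R[i]]_n :=
  (\sum_i \sum_(j | j != i) (A i j * x j j) *: delta_mx i i) +
  (\sum_i \sum_(j | j != i) (C i j * x j i) *: delta_mx i j).

Fact XAC_is_linear (A C : 'M[R[i]]_n) : linear (XAC A C).
Proof.
move=> a x y; rewrite /XAC scalerDr addrACA; congr (_ + _).
  rewrite scaler_sumr -big_split /=; apply: eq_bigr => i _.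
  rewrite scaler_sumr -big_split /=; apply: eq_bigr => j _.
  by rewrite !mxE scalerA -scalerDl mulrDr mulrCA.
rewrite scaler_sumr -big_split /=; apply: eq_bigr => i _.
rewrite scaler_sumr -big_split /=; apply: eq_bigr => j _.
by rewrite !mxE scalerA -scalerDl mulrDr mulrCA.
Qed.

HB.instance Definition _ (A C : 'M[R[i]]_n) :=
  GRing.isLinear.Build R[i] 'M[R[i]]_n 'M[R[i]]_n *:%R (XAC A C)
    (XAC_is_linear A C).

End QuantumGraphs.

Section StrangeGraphs.
Variables (R : realType).

Definition mx22 (a b c d : R[i]) : 'M[R[i]]_2 :=
  \matrix_(r < 2, s < 2)
    if r == 0 then (if s == 0 then a else b) else (if s == 0 then c else d).

Definition expi (t : R) : R[i] := cos t +i* sin t.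

Definition Xblock n (A C : 'M[R[i]]_n) (i j : 'I_n) : 'M[R[i]]_2 :=
  mx22 (A i j) (C i j) (C j i) (A j i).

Definition phase_block (t : R) : 'M[R[i]]_2 :=
  2^-1 *: mx22 1 (expi t) (expi (- t)) 1.

(* An edge {i, j} is recorded at the ordered pair (i, j) with i < j, since the
   phase of a strange edge depends on the order of its endpoints. *)
Record strange_graph n := StrangeGraph {
  classical_edge : 'I_n -> 'I_n -> Prop;
  strange_edge : 'I_n -> 'I_n -> R -> Prop }.

Definition strange_graph_of n (A C : 'M[R[i]]_n) : strange_graph n :=
  {| classical_edge := fun i j => (i < j)%N /\ Xblock A C i j = 1%:M;
     strange_edge := fun i j t =>
       [/\ (i < j)%N, 0 <= t < 2 * pi & Xblock A C i j = phase_block t] |}.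

Definition has_edge n (S : strange_graph n) (i j : 'I_n) : Prop :=
  classical_edge S i j \/ exists t, strange_edge S i j t.

Definition adjacent n (S : strange_graph n) : rel 'I_n :=
  fun i j => `[< has_edge S i j \/ has_edge S j i >].

Definition num_strange_components n (S : strange_graph n) : nat :=
  n_comp (adjacent S) 'I_n.

End StrangeGraphs.

(* Main.v *)
(* Join the vertices in n/2 disjoint pairs {i, s i} by strange edges of phase 0,
   so that X(x) is half the restriction of S x S to the 2 x 2 blocks of the
   pairs, with S the permutation matrix of s. The strange graph has n/2
   components, but the eigenvectors e_i + e_(s i) and e_i - e_(s i) of S split
   each pair into two components of X. This gives n components, the largest
   possible number because the traces of the projectors are positive integers
   that add up to n. *)
Require Import Defs.
From mathcomp Require Import all_boot all_order all_algebra.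
From mathcomp Require Import complex.
From mathcomp Require Import reals.
From mathcomp Require Import boolp trigo ring.

Set Implicit Arguments.
Unset Strict Implicit.
Unset Printing Implicit Defensive.

Import Order.TTheory GRing.Theory Num.Theory.
Local Open Scope ring_scope.
Local Open Scope complex_scope.
Local Open Scope sesquilinear_scope.

(** In the rank factorization [P = col_base P *m row_base P], cancelling the full-rank outer factors
    in [P *m P = P] leaves [row_base P *m col_base P = 1], an identity of size [\rank P]; the trace
    is cyclic. *)
Lemma idempotent_mxtrace (F : fieldType) n (P : 'M[F]_n) :
  P *m P = P -> \tr P = (\rank P)%:R.
Proof.
move=> PP; rewrite -[in LHS](mulmx_base P) mxtrace_mulC -mxtrace1.
congr (\tr _); apply: (row_full_inj (col_base_full P)).
apply: (row_free_inj (row_base_free P)).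
by rewrite mulmx1 -mulmxA -(mulmxA (row_base P)) mulmx_base mulmxA mulmx_base.
Qed.

Lemma has_components_le (R : realType) n
    (G : {linear 'M[R[i]]_n -> 'M[R[i]]_n}) k :
  has_components G k -> (k <= n)%N.
Proof.
case=> P [P_proj sumP _]; have /(congr1 mxtrace) := sumP.
rewrite mxtrace1 raddf_sum /=.
under eq_bigr => t _ do rewrite (idempotent_mxtrace (P_proj t).1.1).
rewrite -natr_sum => /eqP; rewrite eqr_nat => /eqP <-.
rewrite -[leqLHS]card_ord -sum1_card; apply: leq_sum => t _.
by rewrite lt0n mxrank_eq0; have [] := P_proj t.
Qed.

Section PerfectMatching.
Variables (R : realType) (n : nat) (s : 'I_n -> 'I_n) (p : pred 'I_n).
Hypotheses (sK : involutive s) (ps : forall i, p (s i) = ~~ p i).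

Definition linked i j := (j == i) || (j == s i).

(** Serves as both [A] and [C]: a strange edge of phase 0 has all four block entries equal to
    1/2. *)
Definition matching_mx : 'M[R[i]]_n :=
  \matrix_(i, j) (2^-1 *+ (j == s i)).

Lemma matching_neq i : (s i == i) = false.
Proof. by apply/eqP => si; have := ps i; rewrite si; case: (p i). Qed.

Lemma matching_adj i j : (j == s i) = (s j == i).
Proof. by rewrite -(inj_eq (inv_inj sK)) sK. Qed.

Lemma linkedxx i : linked i i.
Proof. by rewrite /linked eqxx. Qed.

Lemma linked_sym : symmetric linked.
Proof.
by move=> i j; rewrite /linked matching_adj [j == i]eq_sym [s j == i]eq_sym.
Qed.

Lemma linkedsr i j : linked i (s j) = linked i j.
Proof. by rewrite /linked (inj_eq (inv_inj sK)) orbC matching_adj. Qed.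

Lemma linkedsl i j : linked (s i) j = linked i j.
Proof. by rewrite linked_sym linkedsr linked_sym. Qed.

Lemma linked_trans i j : linked i j -> linked i =1 linked j.
Proof. by case/orP => /eqP -> // k; rewrite linkedsl. Qed.

Lemma sum_linked i (F : 'I_n -> R[i]) :
  \sum_(j | linked i j) F j = F i + F (s i).
Proof.
rewrite (bigD1 i) ?linkedxx //= (bigD1 (s i)) /=; last first.
  by rewrite linkedsr linkedxx matching_neq.
by rewrite big1 ?addr0 // /linked => j; case: (j == i); case: (j == s i).
Qed.

Lemma sum_matching_mx (V : lmodType R[i]) i (F : 'I_n -> R[i]) (D : 'I_n -> V) :
  \sum_(j | j != i) (matching_mx i j * F j) *: D j
  = (2^-1 * F (s i)) *: D (s i).
Proof.
rewrite (bigD1 (s i)) ?matching_neq //= mxE eqxx big1 ?addr0 // => j.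
by case/andP=> _ /negPf jsi; rewrite mxE jsi mul0r scale0r.
Qed.

(** The [A] part fills the entries [(a, a)] and the [C] part the entries [(a, s a)]; since
    [s (s a) = a], one formula covers both. *)
Lemma XAC_matchingE x :
  XAC matching_mx matching_mx x =
  \matrix_(a, b) ((2^-1 * x (s a) (s b)) *+ linked a b).
Proof.
apply/matrixP => a b; rewrite [RHS]mxE /XAC !(mxE, summxE).
under eq_bigr do rewrite sum_matching_mx.
under [in X in _ + X]eq_bigr do rewrite sum_matching_mx.
rewrite (bigD1 a) //= big1 => [|i /negPf ia]; last first.
  by rewrite !mxE eq_sym ia mulr0.
rewrite (bigD1 a) //= big1 => [|i /negPf ia]; last first.
  by rewrite !mxE [a == i]eq_sym ia mulr0.
rewrite !mxE eqxx /linked; case: eqP => [->|_] /=.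
  by rewrite eq_sym matching_neq !mulr0 !addr0 mulr1.
by case: eqP => [->|_]; rewrite ?sK !mulr0 !(addr0, add0r) ?mulr1.
Qed.

Lemma matching_loopless : loopless (XAC matching_mx matching_mx).
Proof.
move=> i j; apply/matrixP => a b; rewrite summxE mxE big1 // => k _.
rewrite mxE big1 // => c _; rewrite /= XAC_matchingE !mxE.
(* Column [k] of the image of [delta_mx i k] carries the factor [s k == k], which vanishes. *)
have [->|] := eqVneq c k; last by rewrite mulr0.
by rewrite matching_neq andbF mulr0 mul0rn mul0r.
Qed.

Lemma matching_undirected : undirected (XAC matching_mx matching_mx).
Proof.
move=> x y; rewrite /hs_inner /= !XAC_matchingE /mxtrace.
rewrite (reindex_inj (inv_inj sK)) /=.
apply: eq_bigr => a _; rewrite !mxE (reindex_inj (inv_inj sK)) /=.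
apply: eq_bigr => b _; rewrite !mxE !sK linkedsl linkedsr.
rewrite linked_sym; case: linked; rewrite ?mulr0n ?rmorph0 ?mul0r ?mulr0 //.
by rewrite !mulr1n rmorphM fmorphV rmorph_nat /= mulrCA mulrA.
Qed.

Lemma matching_quantum_graph : quantum_graph (XAC matching_mx matching_mx).
Proof.
split=> [i j|x]; apply/matrixP => a b; last first.
  rewrite /= !XAC_matchingE !mxE linked_sym.
  case: linked; rewrite ?mulr0n ?rmorph0 //.
  by rewrite !mulr1n rmorphM fmorphV rmorph_nat.
rewrite summxE; under eq_bigr do rewrite mxE; rewrite exchange_big /=.
(* The coefficient 1/2 is spread as 1/4 over the two indices [c] linked to [a], to match the double
   sum term by term: for each [c] only [k = s c] contributes, with 1/2 from each factor. *)
have -> : XAC matching_mx matching_mx (delta_mx i j) a b =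
   \sum_(c | linked a c) (4^-1 * ((s a == i) && (s b == j))%:R *+ linked a b).
  by rewrite sum_linked /= XAC_matchingE !mxE; case: linked; rewrite //=; field.
rewrite [RHS]big_mkcond; apply: eq_bigr => c _.
rewrite (bigD1 (s c)) //= big1 => [|k /negPf kc]; last first.
  rewrite /= !XAC_matchingE !mxE [s c == k]eq_sym kc.
  by rewrite andbF mulr0 mul0rn mul0r.
rewrite /= !XAC_matchingE !mxE eqxx andbT addr0.
have [ac|_] := boolP (linked a c); last by rewrite mulr0n mul0r.
rewrite -(linked_trans ac); case: (linked a b); last by rewrite !mulr0n mulr0.
by case: (s a == i); case: (s b == j); rewrite !mulr1n /=; field.
Qed.

(** The two vertices of a pair get opposite signs, so indexing by vertices meets each eigenvector of
    each swap once. *)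
Definition eigen_sign t : R[i] := (-1) ^+ p t.

(* The projector onto the line spanned by [e_t + eigen_sign t *: e_(s t)], an
   eigenvector of the swap of [t] and [s t]. *)
Definition eigen_proj t : 'M[R[i]]_n :=
  \matrix_(a, b) (2^-1 * ((b == a)%:R + eigen_sign t * (b == s a)%:R)
                   *+ linked t a).

Lemma eigen_signN t : eigen_sign (s t) = - eigen_sign t.
Proof. by rewrite /eigen_sign ps; case: (p t); rewrite ?opprK. Qed.

Lemma eigen_proj_mulE t (x : 'M[R[i]]_n) :
  eigen_proj t *m x =
  \matrix_(a, b) ((2^-1 * (x a b + eigen_sign t * x (s a) b)) *+ linked t a).
Proof.
apply/matrixP => a b; rewrite [RHS]mxE mxE (bigD1 a) //=.
rewrite (bigD1 (s a)) ?matching_neq //= big1 => [|c].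
  rewrite !mxE !eqxx matching_neq eq_sym matching_neq addr0.
  by case: linked; rewrite ?mulr0n ?mul0r ?addr0 //= !mulr1n; ring.
case/andP=> /negPf ca /negPf cs.
by rewrite !mxE ca cs mulr0 addr0 mulr0 mul0rn mul0r.
Qed.

Lemma eigen_proj_projector t : projector (eigen_proj t).
Proof.
split; apply/matrixP => a b.
  rewrite eigen_proj_mulE !mxE linkedsr sK; case: linked; rewrite //= !mulr1n.
  by rewrite /eigen_sign; case: (p t); field.
rewrite !mxE [a == b]eq_sym [a == s b]matching_adj [s a == b]eq_sym.
have [ba|nba] := boolP (linked b a); last first.
  move: nba; rewrite linked_sym => /norP[/negPf -> /negPf ->].
  by rewrite mulr0 addr0 mulr0 !mul0rn rmorph0.
rewrite linked_sym (linked_trans ba) [linked a t]linked_sym.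
by rewrite /eigen_sign rmorphMn rmorphM rmorphD rmorphM rmorphXn rmorphN1
  fmorphV !rmorph_nat.
Qed.

Lemma eigen_proj_neq0 t : eigen_proj t != 0.
Proof.
apply/eqP => /matrixP /(_ t t) /eqP.
rewrite !mxE linkedxx eqxx [t == s t]eq_sym.
by rewrite matching_neq mulr0 addr0 mulr1 invr_eq0 pnatr_eq0.
Qed.

(** In row [a] only [t = a] and [t = s a] contribute; their opposite signs cancel off the
    diagonal. *)
Lemma sum_eigen_proj : \sum_t eigen_proj t = 1%:M.
Proof.
apply/matrixP => a b; rewrite summxE mxE.
under eq_bigr do rewrite mxE linked_sym mulrb.
rewrite -big_mkcond sum_linked eigen_signN [a == b]eq_sym /=.
by field.
Qed.

(** Distinct pairs do not interact. Within a pair, swapping rows [a] and [s a] multiplies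
    [eigen_proj u *m x] by [eigen_sign u] there; X keeps this symmetry, and the projector of
    opposite sign kills it. *)
Lemma eigen_proj_orthogonal t u : t != u ->
  forall x, eigen_proj t *m XAC matching_mx matching_mx (eigen_proj u *m x) = 0.
Proof.
move=> tu x; rewrite !eigen_proj_mulE /= XAC_matchingE.
apply/matrixP => a b; rewrite !mxE linkedsl linkedsr !sK.
have [ta|_] := boolP (linked t a); last by rewrite mulr0n.
case: (linked a b); last by rewrite !mulr0n mulr0 addr0 mulr0.
have [ua|_] := boolP (linked u a); last by rewrite !mulr0n !mulr0 addr0 mulr0.
have ut : u = s t.
  move: ua; rewrite linked_sym -(linked_trans ta).
  by rewrite /linked eq_sym (negPf tu) => /eqP.
by rewrite ut eigen_signN !mulr1n /eigen_sign; case: (p t); field.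
Qed.

Lemma matching_num_components : num_components (XAC matching_mx matching_mx) n.
Proof.
split=> [|m]; last exact: has_components_le.
exists eigen_proj; split=> [t||]; last exact: eigen_proj_orthogonal.
  by split; [apply: eigen_proj_projector | apply: eigen_proj_neq0].
exact: sum_eigen_proj.
Qed.

Lemma matching_adjacent :
  adjacent (strange_graph_of matching_mx matching_mx) =2 frel s.
Proof.
(* For either kind of edge the top-left block entry, 1 or 1/2, is nonzero, whereas [matching_mx i j]
   vanishes unless [j = s i]. *)
have edgeP i j : has_edge (strange_graph_of matching_mx matching_mx) i j ->
    s i == j.
  rewrite eq_sym; apply: contraPT => /negPf ij [|[t]] [] => [_|_ _].
    move/matrixP/(_ 0 0)/eqP; rewrite !mxE ij /=.
    by rewrite eq_sym oner_eq0.
  move/matrixP/(_ 0 0)/eqP; rewrite !mxE ij /= mulr1 eq_sym.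
  by rewrite invr_eq0 pnatr_eq0.
have edge (i : 'I_n) : (i < s i)%N ->
    has_edge (strange_graph_of matching_mx matching_mx) i (s i).
  move=> lti; right; exists 0; split=> //.
    by rewrite lexx mulr_gt0 // pi_gt0.
  apply/matrixP => a b; rewrite !mxE oppr0 /expi cos0 sin0 !sK !eqxx.
  by case: (a == 0); case: (b == 0); rewrite mulr1.
move=> i j; apply/asboolP/idP => [[/edgeP //|/edgeP]|/eqP <-].
  by rewrite /= eq_sym -matching_adj eq_sym.
have [lti|] := ltnP i (s i); first by left; apply: edge.
rewrite leq_eqVlt val_eqE matching_neq /= => lti.
by right; have := edge (s i); rewrite sK; apply.
Qed.

Lemma matching_num_strange_components :
  (2 * num_strange_components (strange_graph_of matching_mx matching_mx))%N = n.
Proof.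
rewrite /num_strange_components (eq_n_comp (eq_connect matching_adjacent)).
(* The components are the orbits of [s], all of size 2. *)
rewrite mulnC (@fcard_order_set _ s (inv_inj sK) 2) ?card_ord //.
apply/subsetP => i _; rewrite inE /= (@order_cycle _ s [:: i; s i]) //=.
- by rewrite sK !eqxx.
- by rewrite inE eq_sym matching_neq.
- by rewrite inE eqxx.
Qed.

End PerfectMatching.

Theorem proposition4p13 (R : realType) (n : nat)
    (n_ge2 : (2 <= n)%N) (n_even : ~~ odd n) :
  exists A C : 'M[R[i]%C]_n,
    [/\ zero_diagonal A /\ zero_diagonal C,
        quantum_graph (XAC A C),
        undirected (XAC A C),
        loopless (XAC A C) &
        num_components (XAC A C)
          (2 * num_strange_components (strange_graph_of A C))%N].
Proof.
(* The pairs are [{2m, 2m+1}], told apart by parity; as [n] is even, an even [i < n] has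
   [i.+1 < n]. *)
have swap_lt (i : 'I_n) : ((if odd i then i.-1 else i.+1) < n)%N.
  have [_|ei] := ifP; first exact: leq_ltn_trans (leq_pred i) (ltn_ord i).
  rewrite ltn_neqAle ltn_ord andbT; apply: contraNneq n_even => <-.
  by rewrite /= ei.
pose s i := Ordinal (swap_lt i).
have sodd i : odd (s i) = ~~ odd i.
  rewrite /=; case: ifP => /= [oi|->] //.
  by move: oi; case: (nat_of_ord i) => //= k /negPf.
have sK : involutive s.
  have sE i : s i = (if odd i then i.-1 else i.+1) :> nat by [].
  move=> i; apply: ord_inj; rewrite sE sodd sE.
  case oi: (odd i) => //=.
  by rewrite prednK //; case: (nat_of_ord i) oi.
exists (matching_mx R s), (matching_mx R s).
have diag0 : zero_diagonal (matching_mx R s).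
  by move=> i; rewrite mxE eq_sym (matching_neq sodd).
split=> //.
- exact: matching_quantum_graph sK sodd.
- exact: matching_undirected sK sodd.
- exact: matching_loopless sK sodd.
- rewrite (matching_num_strange_components _ sK sodd).
  exact: matching_num_components sK sodd.
Qed.
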